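(* Let $F$ be a non-abelian free group of finite rank, let $\iota_1,\iota_2:F\to F*F$ be the canonical inclusions of the two factors, and let $\iota:F\to F*F$ be the map $\iota(g)=\iota_1(g)\iota_2(g)$. Then $\iota$ is not quasi-Ulam. In fact, it does not satisfy either of the two conditions of the definition: there is no finite set $E\subset F*F$ such that $\iota(gh)\in E\iota(g)E\iota(h)E$ for all $g,h\in F$ with $gh$ reduced, and there is no finite set $E\subset F*F$ such that $\iota(g^{-1})\in E\iota(g)^{-1}E$ for all $g\in F$.
   Context: $F$ has a fixed basis; for $g,h\in F$ the product $gh$ is reduced if $|gh|=|g|+|h|$ for the word length. A map $f:F\to G$ to a group $G$ is quasi-Ulam if there exists a finite set $E\subset G$ such that: (1) if $g,h\in F$ are such that $gh$ is reduced, then $f(gh)\in Ef(g)Ef(h)E$; (2) $f(g^{-1})\in Ef(g)^{-1}E$ for all $g\in F$. *)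

(* Defs.v *)
From mathcomp Require Import all_boot.
From mathcomp Require Import boolp classical_sets cardinality.
Set Implicit Arguments.
Unset Strict Implicit.
Unset Printing Implicit Defensive.
Local Open Scope group_scope.
Local Open Scope classical_set_scope.

(* Free groups and free products are given by their universal properties, so
   that they are covered in every presentation; a multiplicative map between
   groups automatically preserves 1 and inverses. *)

Definition is_free_basis (X : Type) (F : groupType) (b : X -> F) : Prop :=
  forall (G : groupType) (u : X -> G),
    exists f : {multiplicative F -> G},
      (forall x, f (b x) = u x) /\
      (forall f' : {multiplicative F -> G},
          (forall x, f' (b x) = u x) -> f' =1 f).

Definition is_free_product (G1 G2 P : groupType)
    (i1 : {multiplicative G1 -> P}) (i2 : {multiplicative G2 -> P}) : Prop :=
  forall (G : groupType)
      (f1 : {multiplicative G1 -> G}) (f2 : {multiplicative G2 -> G}),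
    exists f : {multiplicative P -> G},
      (forall x, f (i1 x) = f1 x) /\ (forall x, f (i2 x) = f2 x) /\
      (forall f' : {multiplicative P -> G},
          (forall x, f' (i1 x) = f1 x) -> (forall x, f' (i2 x) = f2 x) ->
          f' =1 f).

(* The letter (x, false) stands for b x, and (x, true) for its inverse. *)
Definition word_eval (X : Type) (F : groupType) (b : X -> F)
    (w : seq (X * bool)) : F :=
  \prod_(l <- w) (if l.2 then (b l.1)^-1 else b l.1).

(* The default value 0 is only reached when g is not in the subgroup generated
   by b, hence never when b is a free basis. *)
Definition word_length (X : Type) (F : groupType) (b : X -> F) (g : F) : nat :=
  xget 0%N [set size w | w in [set w : seq (X * bool) |
    word_eval b w = g /\
    forall w', word_eval b w' = g -> (size w <= size w')%N]].

Definition reduced_product (X : Type) (F : groupType) (b : X -> F) (g h : F) :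
    Prop :=
  word_length b (g * h) = (word_length b g + word_length b h)%N.

Definition quasi_ulam_mul (X : Type) (F G : groupType) (b : X -> F)
    (f : F -> G) (E : set G) : Prop :=
  forall g h, reduced_product b g h ->
    exists e1 e2 e3, [/\ E e1, E e2, E e3 &
      f (g * h) = e1 * f g * e2 * f h * e3].

Definition quasi_ulam_inv (F G : groupType) (f : F -> G) (E : set G) : Prop :=
  forall g : F, exists e1 e2, [/\ E e1, E e2 & f g^-1 = e1 * (f g)^-1 * e2].

Definition quasi_ulam (X : Type) (F G : groupType) (b : X -> F)
    (f : F -> G) : Prop :=
  exists E : set G,
    [/\ finite_set E, quasi_ulam_mul b f E & quasi_ulam_inv f E].

(* Main.v *)
From HB Require Import structures.
Require Import Defs.
From mathcomp Require Import all_boot order ssralg ssrnum ssrint.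
From mathcomp Require Import boolp classical_sets cardinality.
From mathcomp Require Import zify ring.
Import Order.TTheory GRing.Theory Num.Theory.
Local Open Scope group_scope.
Local Open Scope classical_set_scope.

(** Fix a basis element [x] of [F] and map [F * F] to the integral Heisenberg
    group, sending every basis element of the first factor to [a = (1, 0, 0)]
    and of the second to [c = (0, 1, 0)]. The central coordinate of
    [iota (x ^ n)], that is of [a^n c^n], is [n^2], whereas that of its reversal
    [c^n a^n] is [0]; likewise [a^2n c^2n] and [(a^n c^n)^2] have the same image
    in the abelianization but central coordinates [4 n^2] and [3 n^2].
    Multiplying by elements of a fixed finite set changes the central coordinate
    of such elements only by a quantity linear in [n], provided that the image
    in the abelianization is unchanged, so no finite set can account for the
    discrepancy. *)

(* [(a, b, c)] stands for the unitriangular matrix [[1,a,c],[0,1,b],[0,0,1]]. *)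
Definition heis : Type := (int * int * int)%type.

HB.instance Definition _ := Choice.on heis.

Definition heis_mul (u v : heis) : heis :=
  (u.1.1 + v.1.1, u.1.2 + v.1.2, u.2 + v.2 + u.1.1 * v.1.2)%R.

Definition heis_one : heis := (0, 0, 0)%R.

Definition heis_inv (u : heis) : heis :=
  (- u.1.1, - u.1.2, u.1.1 * u.1.2 - u.2)%R.

Lemma heis_mulA : associative heis_mul.
Proof.
by move=> [[a b] c] [[a' b'] c'] [[a'' b''] c'']; rewrite /heis_mul /=;
  congr (_, _, _); ring.
Qed.

Lemma heis_1mul : left_id heis_one heis_mul.
Proof.
by move=> [[a b] c]; rewrite /heis_mul /=; congr (_, _, _); ring.
Qed.

Lemma heis_mul1 : right_id heis_one heis_mul.
Proof.
by move=> [[a b] c]; rewrite /heis_mul /=; congr (_, _, _); ring.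
Qed.

Lemma heis_Vmul : left_inverse heis_one heis_inv heis_mul.
Proof.
by move=> [[a b] c]; rewrite /heis_mul /heis_one /=; congr (_, _, _); ring.
Qed.

Lemma heis_mulV : right_inverse heis_one heis_inv heis_mul.
Proof.
by move=> [[a b] c]; rewrite /heis_mul /heis_one /=; congr (_, _, _); ring.
Qed.

HB.instance Definition _ :=
  isGroup.Build heis heis_mulA heis_1mul heis_mul1 heis_Vmul heis_mulV.

Definition heis_a : heis := (1, 0, 0)%R.
Definition heis_c : heis := (0, 1, 0)%R.

Lemma heis_mulE (u v : heis) :
  u * v = (u.1.1 + v.1.1, u.1.2 + v.1.2, u.2 + v.2 + u.1.1 * v.1.2)%R :> heis.
Proof. by []. Qed.

Lemma heis_invE (u : heis) :
  u^-1 = (- u.1.1, - u.1.2, u.1.1 * u.1.2 - u.2)%R :> heis.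
Proof. by []. Qed.

Lemma heis_aX (k : nat) : heis_a ^+ k = (k%:Z, 0, 0)%R :> heis.
Proof.
elim: k => [//|k IHk]; rewrite expgS IHk heis_mulE /=.
by congr (_, _, _); lia.
Qed.

Lemma heis_cX (k : nat) : heis_c ^+ k = (0, k%:Z, 0)%R :> heis.
Proof.
elim: k => [//|k IHk]; rewrite expgS IHk heis_mulE /=.
by congr (_, _, _); lia.
Qed.

(** A crude norm: bounding it bounds all three coordinates at once, which is how finiteness of [E]
    enters. *)
Definition heis_size (u : heis) : nat := (`|u.1.1| + `|u.1.2| + `|u.2|)%N.

Lemma finite_set_bounded_nat (T : eqType) (E : set T) (f : T -> nat) :
  finite_set E -> exists C, forall x, E x -> (f x <= C)%N.
Proof.
move=> /finite_seqP[s ->]; exists (\max_(x <- s) f x)%N => x /= xs.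
exact: leq_bigmax_seq.
Qed.

Lemma mul_abs_bound (x y : int) (m k : nat) : (`|x| <= m)%N -> (`|y| <= k)%N ->
  (x * y <= m%:Z * k%:Z)%R.
Proof.
move=> xm yk; apply: (@le_trans _ _ `|x * y|%R); first exact: ler_norm.
by rewrite normrM; apply: ler_pM => //; lia.
Qed.

(** The second coordinates force [q' = - q]; the central ones then give
    [k^2 = r + r' - p q + (p - q) k], at most [2 C + C^2 + C k]. *)
Lemma heis_reversal_gap (C k : nat) (u v : heis) :
  (heis_size u <= C)%N -> (heis_size v <= C)%N -> (4 * C < k)%N ->
  heis_a ^+ k * heis_c ^+ k <> u * (heis_c ^+ k * heis_a ^+ k) * v.
Proof.
case: u v => [[p q] r] [[p' q'] r']; rewrite /heis_size /= => uC vC kC.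
rewrite heis_aX heis_cX !heis_mulE /= => -[E1 E2 E3].
have Dq : (q' = - q)%R by lia.
have pq : (- p * q <= C%:Z * C%:Z)%R by apply: mul_abs_bound; lia.
have pqk : ((p - q) * k%:Z <= C%:Z * k%:Z)%R by apply: mul_abs_bound; lia.
(* Products are atoms for [lia], so [4 * C + 1 <= k] is supplied multiplied by [k] and by [C]. *)
have kk : ((4 * C%:Z + 1) * k%:Z <= k%:Z * k%:Z)%R.
  by apply: ler_wpM2r; lia.
have Ck : (C%:Z * (4 * C%:Z + 1) <= C%:Z * k%:Z)%R.
  by apply: ler_wpM2l; lia.
rewrite {}Dq in E3.
lia.
Qed.

(** Central coordinates: [4 k^2] on the left; on the right [3 k^2 + (2 p1 + p2 + q2 + 2 q3) k] plus
    terms bounded in [C] alone. *)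
Lemma heis_square_gap (C k : nat) (u v w : heis) :
  (heis_size u <= C)%N -> (heis_size v <= C)%N -> (heis_size w <= C)%N ->
  (12 * C < k)%N ->
  heis_a ^+ (k + k) * heis_c ^+ (k + k) <>
  u * (heis_a ^+ k * heis_c ^+ k) * v * (heis_a ^+ k * heis_c ^+ k) * w.
Proof.
case: u v w => [[p1 q1] r1] [[p2 q2] r2] [[p3 q3] r3].
rewrite /heis_size /= => uC vC wC kC.
rewrite !heis_aX !heis_cX !heis_mulE /= !PoszD => -[E1 E2 E3].
have pq2 : (p1 * q2 <= C%:Z * C%:Z)%R by apply: mul_abs_bound; lia.
have pq3 : ((p1 + p2) * q3 <= (2 * C)%N%:Z * C%:Z)%R by apply: mul_abs_bound; lia.
have pqk : ((2 * p1 + p2 + q2 + 2 * q3) * k%:Z <= (6 * C)%N%:Z * k%:Z)%R.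
  by apply: mul_abs_bound; lia.
have kk : ((12 * C%:Z + 1) * k%:Z <= k%:Z * k%:Z)%R.
  by apply: ler_wpM2r; lia.
have Ck : (C%:Z * (12 * C%:Z + 1) <= C%:Z * k%:Z)%R.
  by apply: ler_wpM2l; lia.
lia.
Qed.

(* The library states these for [UMagmaMorphism.type], where preservation of 1 is
   a hypothesis; between groups it is automatic. *)
Lemma multiplicative1 (G H : groupType) (f : {multiplicative G -> H}) : f 1 = 1.
Proof. by apply: (mulgI (f 1)); rewrite -gmulfM !mulg1. Qed.

Lemma multiplicativeV (G H : groupType) (f : {multiplicative G -> H}) :
  {morph f : x / x^-1}.
Proof.
by move=> x; apply: (mulgI (f x)); rewrite -gmulfM !mulgV multiplicative1.
Qed.

Lemma multiplicativeX (G H : groupType) (f : {multiplicative G -> H}) k :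
  {morph f : x / x ^+ k}.
Proof.
move=> x; elim: k => [|k IHk]; first exact: multiplicative1.
by rewrite !expgS gmulfM IHk.
Qed.

(** Over an empty basis the identity and the trivial map extend the same function, so they agree and
    [F] is trivial. *)
Lemma free_basis_inhabited (X : Type) (F : groupType) (b : X -> F) :
  is_free_basis b -> (exists x y : F, x * y <> y * x) -> exists x : X, True.
Proof.
move=> free_F [g [h ghE]]; apply: contrapT => noX.
have [f [_ f_uniq]] := free_F F b.
have trivF z : z = 1 :> F.
  have -> : z = f z by apply: (f_uniq idfun).
  by apply/esym; apply: (f_uniq (@one_fun F F)) => x; case: noX; exists x.
by apply: ghE; rewrite (trivF g) (trivF h).
Qed.

(** For the lower bound, send every basis element to [heis_a]: the first coordinate becomes the
    exponent sum, which no word exceeds in length. *)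
Lemma word_length_basisX (X : Type) (F : groupType) (b : X -> F) (x : X)
    (k : nat) :
  is_free_basis b -> word_length b (b x ^+ k) = k.
Proof.
move=> free_F; have [f [fb _]] := free_F heis (fun=> heis_a).
have eval0 : word_eval b [::] = 1 by rewrite /word_eval big_nil.
have evalS l w :
    word_eval b (l :: w) = (if l.2 then (b l.1)^-1 else b l.1) * word_eval b w.
  by rewrite /word_eval big_cons.
have evalX : word_eval b (nseq k (x, false)) = b x ^+ k.
  by elim: k => [//|k IHk]; rewrite evalS IHk expgS.
have le_size w : (`|(f (word_eval b w)).1.1| <= size w)%N.
  elim: w => [|[y []] w IHw]; first by rewrite eval0 multiplicative1.
    by rewrite evalS gmulfM multiplicativeV fb heis_mulE heis_invE /=; lia.
  by rewrite evalS gmulfM fb heis_mulE /=; lia.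
have le_k w : word_eval b w = b x ^+ k -> (k <= size w)%N.
  by move=> wE; have := le_size w; rewrite wE multiplicativeX fb heis_aX.
(* The set of minimal sizes is exactly [{k}], so the default 0 is not what [xget] falls back on. *)
apply: xget_unique => /=.
  exists (nseq k (x, false)); last by rewrite size_nseq.
  by split=> // w /le_k; rewrite size_nseq.
move=> _ [w [wE wmin] <-]; apply/eqP; rewrite eqn_leq le_k // andbT.
by have := wmin _ evalX; rewrite size_nseq.
Qed.

Theorem lemma5p18 (n : nat) (F : groupType) (b : 'I_n -> F)
    (free_F : is_free_basis b)
    (nonabelian_F : exists x y : F, x * y <> y * x)
    (FF : groupType) (i1 i2 : {multiplicative F -> FF})
    (free_product_FF : is_free_product i1 i2) :
  let iota := fun g : F => i1 g * i2 g in
  [/\ ~ quasi_ulam b iota,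
      ~ (exists E : set FF, finite_set E /\ quasi_ulam_mul b iota E)
    & ~ (exists E : set FF, finite_set E /\ quasi_ulam_inv iota E)].
Proof.
move=> iota.
have [x _] := free_basis_inhabited _ _ _ free_F nonabelian_F.
have [f1 [f1b _]] := free_F heis (fun=> heis_a).
have [f2 [f2b _]] := free_F heis (fun=> heis_c).
have [phi [phi1 [phi2 _]]] := free_product_FF heis f1 f2.
have phi_iota g : phi (iota g) = f1 g * f2 g by rewrite gmulfM phi1 phi2.
clearbody iota.
have phi_iotaX k : phi (iota (b x ^+ k)) = heis_a ^+ k * heis_c ^+ k.
  by rewrite phi_iota !multiplicativeX f1b f2b.
have not_mul : ~ exists E : set FF, finite_set E /\ quasi_ulam_mul b iota E.
  move=> [E [finE mulE]].
  have [C EC] := finite_set_bounded_nat _ _ (fun e => heis_size (phi e)) finE.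
  pose k := (12 * C).+1.
  have [|e1 [e2 [e3 [E1 E2 E3 eqE]]]] := mulE (b x ^+ k) (b x ^+ k).
    by rewrite /reduced_product -expgnDr !word_length_basisX.
  apply: (heis_square_gap C k (phi e1) (phi e2) (phi e3)); rewrite ?EC //.
  by rewrite -phi_iotaX expgnDr eqE !gmulfM !phi_iotaX.
have not_inv : ~ exists E : set FF, finite_set E /\ quasi_ulam_inv iota E.
  move=> [E [finE invE]].
  have [C EC] := finite_set_bounded_nat _ _ (fun e => heis_size (phi e)) finE.
  pose k := (4 * C).+1.
  (* At this inverse, [phi] sends [iota g^-1] to [a^k c^k] and [(iota g)^-1] to
     [(a^-k c^-k)^-1 = c^k a^k]. *)
  have [e1 [e2 [E1 E2]]] := invE (b x ^+ k)^-1.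
  rewrite invgK => eqE.
  apply: (heis_reversal_gap C k (phi e1) (phi e2)); rewrite ?EC //.
  rewrite -phi_iotaX eqE !gmulfM; congr (_ * _ * _).
  rewrite multiplicativeV phi_iota !multiplicativeV invgM !invgK.
  by rewrite !multiplicativeX f1b f2b.
by split=> // -[E [finE mulE invE]]; apply: not_mul; exists E.
Qed.
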